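(* Let $G=\mathbb{Z}_k\rtimes_n\mathbb{Z}_{ql}$ and let $c=\gcd(n-1,k)$. Let $s,t\in\mathbb{Z}$, let $\mu_{ql}$ and $\mu_c$ be fixed primitive $ql$-th and $c$-th roots of unity, and let $V$ be the 1-dimensional $G$-module with character $\chi=\xi_s\otimes\psi_t$, where $\xi_s(b)=\mu_{ql}^s$ and $\psi_t(a)=\mu_c^t$; that is, $\chi(a^xb^y)=\mu_c^{tx}\mu_{ql}^{sy}$ for all $x,y\in\mathbb{Z}$. Then for every $m\in\mathbb{N}$, $$\nu_m(V)=\begin{cases}1 & \text{if } c\mid mt \text{ and } ql\mid ms,\\ 0 & \text{if } c\nmid mt \text{ or } ql\nmid ms.\end{cases}$$
   Context: $\mathbb{N}=\{1,2,3,\dots\}$. Let $k,q,l,n\in\mathbb{N}$ with $q$ a prime dividing $|\mathrm{Aut}(\mathbb{Z}_k)|$, $n^q\equiv 1\bmod k$ and $n\not\equiv 1\bmod k$. Then $\mathbb{Z}_k\rtimes_n\mathbb{Z}_{ql}$ denotes the (non-abelian, order $kql$) group $\langle a,b\mid a^k=b^{ql}=1,\ bab^{-1}=a^n\rangle$. For a finite group $G$ and a finite-dimensional complex $G$-module $V$ with character $\chi$, the $m$-th (Frobenius–Schur) indicator is $\nu_m(V)=\frac{1}{|G|}\sum_{g\in G}\chi(g^m)$. *)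

(* Defs.v *)
From HB Require Import structures.
From mathcomp Require Import all_boot all_order all_algebra all_fingroup.
From mathcomp Require Import all_solvable all_field all_character.

Set Implicit Arguments.
Unset Strict Implicit.
Unset Printing Implicit Defensive.

Import GroupScope GRing.Theory.

Definition zexpg (gT : finGroupType) (g : gT) (z : int) : gT :=
  match z with Posz i => g ^+ i | Negz i => g ^- i.+1 end.

(* G = < a, b | a^k = b^r = 1, b a b^-1 = a^n >, with a and b the two          *)
(* generators of the presentation. The isog clause only determines G up to    *)
(* isomorphism; the other clauses single out a and b. Since G is finite, the   *)
(* surjection from the presented group onto G defined by a and b is then       *)
(* injective. The clause with Grp quantifies over finite groups only, which    *)
(* is harmless here: for 0 < k and 0 < r the presented group is finite, as     *)
(* every element has the form a^x b^y.                                         *)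
Definition metacyclic_presentation (k r n : nat) (gT : finGroupType)
    (G : {group gT}) (a b : gT) : Prop :=
  [/\ G :=: <<[set a; b]>>,
      a ^+ k = 1, b ^+ r = 1, b * a * b^-1 = a ^+ n &
      G \isog Grp (x : y : x ^+ k, y ^+ r, y * x * y^-1 = x ^+ n)].

(* The library's cfRepr is restricted to algC; this is the same function, for  *)
(* representations over an arbitrary field.                                    *)
Definition mxchar (F : fieldType) (gT : finGroupType) (G : {group gT})
    (d : nat) (V : mx_representation F G d) (g : gT) : F :=
  (\tr (V g))%R.

Definition FS_indicator (F : fieldType) (gT : finGroupType) (G : {group gT})
    (d : nat) (V : mx_representation F G d) (m : nat) : F :=
  ((#|G|%:R)^-1 * \sum_(g in G) mxchar V (g ^+ m)%g)%R.

(* Main.v *)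
(* The character chi of a 1-dimensional module is multiplicative, so           *)
(* g |-> chi (g ^+ m) is the linear character chi ^+ m. The average of a       *)
(* linear character over G is 1 if it is trivial and 0 otherwise, and           *)
(* triviality is tested on the generators a and b.                              *)
Require Import Defs.
From HB Require Import structures.
From mathcomp Require Import all_boot all_order all_algebra all_fingroup.
From mathcomp Require Import all_solvable all_field all_character.

Set Implicit Arguments.
Unset Strict Implicit.
Unset Printing Implicit Defensive.

Import GRing.Theory.
Local Open Scope ring_scope.

(** With chi the character of [V], the indicator averages over [G] the multiplicative map psi(g) =
    chi(g)^m. By [sum_group_morph_eq0] the sum vanishes unless psi is trivial, when the average is
    1. By [group_morph_gen_eq1] triviality is decided at [a] and [b], where psi takes the values
    mu_c^(mt) and mu_ql^(ms); [prim_exprz_eq1] turns these into the two divisibility conditions. *)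

Lemma prim_exprz_eq1 (F : fieldType) (n : nat) (z : F) (i : int) :
  n.-primitive_root z -> (z ^ i == 1) = (n%:Z %| i)%Z.
Proof.
move=> z_prim; rewrite dvdzE absz_nat (prim_order_dvd z_prim).
by case: i => i //=; rewrite NegzE -exprnN invr_eq1.
Qed.

(** Left translation by [g0] permutes [G], so the sum S satisfies psi(g0) S = S; without zero
    divisors, S = 0. *)
Lemma sum_group_morph_eq0 (R : idomainType) (gT : finGroupType)
    (G : {group gT}) (psi : gT -> R) (g0 : gT) :
    {in G &, {morph psi : x y / (x * y)%g >-> x * y}} ->
    g0 \in G -> psi g0 != 1 ->
  \sum_(g in G) psi g = 0.
Proof.
move=> psiM Gg0 psi_g0.
suff: (psi g0 - 1) * \sum_(g in G) psi g = 0.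
  by move/eqP; rewrite mulf_eq0 subr_eq0 (negPf psi_g0) => /eqP.
rewrite mulrBl mul1r mulr_sumr.
rewrite [X in _ - X](reindex_inj (mulgI g0)) /=.
rewrite [X in _ - X](eq_bigl (mem G)) => [|g]; last exact: groupMl.
by apply/eqP; rewrite subr_eq0; apply/eqP/eq_bigr => g Gg; rewrite psiM.
Qed.

(** The elements where [psi] is 1 form a subgroup containing [A]; by finiteness, closure under
    products suffices. *)
Lemma group_morph_gen_eq1 (R : nzRingType) (gT : finGroupType)
    (G : {group gT}) (A : {set gT}) (psi : gT -> R) :
    {in G &, {morph psi : x y / (x * y)%g >-> x * y}} -> psi 1%g = 1 ->
    G :=: <<A>>%g -> {in A, forall g, psi g = 1} ->
  {in G, forall g, psi g = 1}.
Proof.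
move=> psiM psi1 genG psiA.
have gK: group_set [set g in G | psi g == 1].
  apply/group_setP; split=> [|x y]; first by rewrite inE group1 psi1 eqxx.
  rewrite !inE => /andP[Gx /eqP x1] /andP[Gy /eqP y1].
  by rewrite groupM // psiM // x1 y1 mulr1 eqxx.
have sGK: <<A>>%g \subset Group gK.
  rewrite gen_subG; apply/subsetP => g Ag.
  by rewrite inE psiA // eqxx genG mem_gen.
by move=> g; rewrite genG => /(subsetP sGK); rewrite inE => /andP[_ /eqP].
Qed.

Lemma mxchar1M (F : fieldType) (gT : finGroupType) (G : {group gT})
    (V : mx_representation F G 1) :
  {in G &, {morph mxchar V : x y / (x * y)%g >-> x * y}}.
Proof.
move=> x y Gx Gy.
by rewrite /mxchar repr_mxM // !trace_mx11 mxE big_ord1.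
Qed.

Lemma mxchar1_id (F : fieldType) (gT : finGroupType) (G : {group gT})
    (V : mx_representation F G 1) : mxchar V 1%g = 1.
Proof. by rewrite /mxchar repr_mx1 mxtrace1. Qed.

Lemma mxchar1X (F : fieldType) (gT : finGroupType) (G : {group gT})
    (V : mx_representation F G 1) (m : nat) :
  {in G, {morph mxchar V : x / (x ^+ m)%g >-> x ^+ m}}.
Proof.
move=> x Gx; elim: m => [|m IHm]; first by rewrite expg0 mxchar1_id expr0.
by rewrite expgS mxchar1M ?groupX // IHm exprS.
Qed.

(* C is any numClosedFieldType; this covers the complex numbers R[i] over any  *)
(* model R of the reals, as well as algC.                                      *)
Theorem theorem3p3 (C : numClosedFieldType) (k q l n : nat)
    (k_gt0 : (0 < k)%N) (l_gt0 : (0 < l)%N) (n_gt0 : (0 < n)%N)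
    (q_prime : prime q) (q_dvd_aut : (q %| #|Aut (Zp k)|)%N)
    (nq_eq1 : (n ^ q = 1 %[mod k])%N) (n_neq1 : (n <> 1 %[mod k])%N)
    (gT : finGroupType) (G : {group gT}) (a b : gT)
    (presG : metacyclic_presentation k (q * l) n G a b)
    (s t : int) (mu_ql mu_c : C)
    (mu_ql_prim : (q * l)%N.-primitive_root mu_ql)
    (mu_c_prim : (gcdn (n - 1) k).-primitive_root mu_c)
    (V : mx_representation C G 1)
    (chiV : forall x y : int,
        mxchar V (zexpg a x * zexpg b y)%g = mu_c ^ (t * x) * mu_ql ^ (s * y))
    (m : nat) (m_gt0 : (0 < m)%N) :
  FS_indicator V m =
    if ((gcdn (n - 1) k)%:Z %| m%:Z * t)%Z && ((q * l)%N%:Z %| m%:Z * s)%Z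
    then 1 else 0.
Proof.
have [genG _ _ _ _] := presG.
have Ga: a \in G by rewrite genG mem_gen // !inE eqxx.
have Gb: b \in G by rewrite genG mem_gen // !inE eqxx orbT.
pose psi g := mxchar V g ^+ m.
have psiM: {in G &, {morph psi : x y / (x * y)%g >-> x * y}}.
  by move=> x y Gx Gy; rewrite /psi mxchar1M // exprMn.
have psi1: psi 1%g = 1 by rewrite /psi mxchar1_id expr1n.
have psi_a: (psi a == 1) = ((gcdn (n - 1) k)%:Z %| m%:Z * t)%Z.
  (* The exponents (1, 0) isolate [a]: chi(a) = mu_c^t. *)
  have := chiV 1 0; rewrite /= expg1 expg0 mulg1 mulr1 mulr0 expr0z mulr1.
  by rewrite /psi => ->; rewrite exprnP exprz_exp mulrC (prim_exprz_eq1 _ mu_c_prim).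
have psi_b: (psi b == 1) = ((q * l)%N%:Z %| m%:Z * s)%Z.
  have := chiV 0 1; rewrite /= expg1 expg0 mul1g mulr1 mulr0 expr0z mul1r.
  by rewrite /psi => ->; rewrite exprnP exprz_exp mulrC (prim_exprz_eq1 _ mu_ql_prim).
rewrite -psi_a -psi_b /FS_indicator.
rewrite (eq_bigr psi) => [|g Gg]; last exact: mxchar1X.
case: ifPn => [/andP[/eqP a1 /eqP b1] | ].
  have psiG: {in G, forall g, psi g = 1}.
    by apply: group_morph_gen_eq1 genG _ => // g /set2P[] ->.
  by rewrite (eq_bigr _ psiG) sumr_const mulVf // Num.Theory.pnatr_eq0 -lt0n cardG_gt0.
(* Whichever generator has psi different from 1 serves as [g0]. *)
rewrite negb_and => /orP[] /(sum_group_morph_eq0 psiM) -> //; exact: mulr0.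
Qed.
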